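(* Let $(A,\ast,\alpha)$ be a multiplicative Hom-Malcev algebra. Define a ternary operation on $A$ by $$\{x,y,z\}_{\alpha}=2(x\ast y)\ast\alpha(z)-(y\ast z)\ast\alpha(x)-(z\ast x)\ast\alpha(y)\qquad (x,y,z\in A).$$ Then $(A,\{,,\}_{\alpha},\alpha^2)$ is a multiplicative Hom-Lie triple system.
   Context: All vector spaces and algebras are over an algebraically closed field $\mathbb{K}$ of characteristic $0$. A Hom-algebra is a triple $(A,\ast,\alpha)$ where $A$ is a $\mathbb{K}$-vector space, $\ast:A\times A\to A$ is bilinear and $\alpha:A\to A$ is linear. It is multiplicative if $\alpha(x\ast y)=\alpha(x)\ast\alpha(y)$ for all $x,y\in A$. Its Hom-Jacobian is $J_\alpha(x,y,z)=(x\ast y)\ast\alpha(z)+(y\ast z)\ast\alpha(x)+(z\ast x)\ast\alpha(y)$. Powers $\alpha^k$ denote $k$-fold composition. A Hom-Malcev algebra is a Hom-algebra $(A,\ast,\alpha)$ such that $\ast$ is anticommutative and $J_\alpha(\alpha(x),\alpha(y),x\ast z)=J_\alpha(x,y,z)\ast\alpha^2(x)$ for all $x,y,z\in A$. A multiplicative Hom-Lie triple system is a triple $(A,[,,],\beta)$ with $A$ a $\mathbb{K}$-vector space, $[,,]:A\times A\times A\to A$ trilinear and $\beta:A\to A$ linear such that, for all $x,y,z,u,v,w\in A$: (1) $\beta([x,y,z])=[\beta(x),\beta(y),\beta(z)]$; (2) $[x,y,z]=-[y,x,z]$; (3) $[x,y,z]+[y,z,x]+[z,x,y]=0$; (4)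 $[\beta(x),\beta(y),[u,v,w]]=[[x,y,u],\beta(v),\beta(w)]+[\beta(u),[x,y,v],\beta(w)]+[\beta(u),\beta(v),[x,y,w]]$. *)

(* Defs.v *)
From mathcomp Require Import all_boot all_order all_algebra.

Set Implicit Arguments.
Unset Strict Implicit.
Unset Printing Implicit Defensive.

Import GRing.Theory.
Local Open Scope ring_scope.

Section HomAlgebras.

Variables (K : fieldType) (A : lmodType K).

Implicit Types (mul : A -> A -> A) (tri : A -> A -> A -> A).
Implicit Types (alpha beta : A -> A).

Definition hom_algebra mul alpha : Prop :=
  bilinear_for *:%R *:%R mul /\ linear alpha.

Definition multiplicative mul alpha : Prop :=
  forall x y, alpha (mul x y) = mul (alpha x) (alpha y).

Definition anticommutative mul : Prop :=
  forall x y, mul x y = - mul y x.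

Definition hom_jacobian mul alpha (x y z : A) : A :=
  mul (mul x y) (alpha z) + mul (mul y z) (alpha x) + mul (mul z x) (alpha y).

Record hom_malcev_algebra mul alpha : Prop := HomMalcevAlgebra {
  hom_malcev_hom_algebra : hom_algebra mul alpha;
  hom_malcev_anticomm : anticommutative mul;
  hom_malcev_identity : forall x y z,
    hom_jacobian mul alpha (alpha x) (alpha y) (mul x z)
    = mul (hom_jacobian mul alpha x y z) (iter 2 alpha x)
}.

Definition trilinear tri : Prop :=
  [/\ forall y z, linear (fun x => tri x y z),
      forall x z, linear (fun y => tri x y z)
    & forall x y, linear (fun z => tri x y z)].

Record multiplicative_hom_lie_triple_system tri beta : Prop :=
  MultiplicativeHomLieTripleSystem {
  hom_lts_trilinear : trilinear tri;
  hom_lts_linear : linear beta;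
  hom_lts_mult : forall x y z,
    beta (tri x y z) = tri (beta x) (beta y) (beta z);
  hom_lts_skew : forall x y z, tri x y z = - tri y x z;
  hom_lts_cyclic : forall x y z, tri x y z + tri y z x + tri z x y = 0;
  hom_lts_nambu : forall x y u v w,
    tri (beta x) (beta y) (tri u v w)
    = tri (tri x y u) (beta v) (beta w)
      + tri (beta u) (tri x y v) (beta w)
      + tri (beta u) (beta v) (tri x y w)
}.

Definition hom_triple mul alpha (x y z : A) : A :=
  2%:R *: mul (mul x y) (alpha z)
  - mul (mul y z) (alpha x) - mul (mul z x) (alpha y).

End HomAlgebras.

(* Main.v *)
Require Import Defs.
From mathcomp Require Import all_boot all_order all_algebra.

Set Implicit Arguments.
Unset Strict Implicit.
Unset Printing Implicit Defensive.

Local Open Scope ring_scope.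

(** Write [L_a] for left multiplication by [a]. The statement rests on one
    identity of degree four: every [L_a] is a derivation of the triple
    product, which with the twists reads
      [alpha^2 a ** {u, v, w} = {a ** u, alpha v, alpha w}
         + {alpha u, a ** v, alpha w} + {alpha u, alpha v, a ** w}]
    ([left_mul_triple_derivation]). By anticommutativity, [{x, y, _}] is the
    operator [2 L_(x ** y) + [L_x, L_y]] up to twists ([tripleE]). Sums and
    commutators of derivations being derivations, it is a derivation of the
    triple product as well, and this is the fundamental identity of a Hom-Lie
    triple system ([triple_nambu]).

    The identity of degree four is a linear combination of three relations.
    Two of them, [mul_derivation_defect] and [jacobian_teichmuller], hold in
    every anticommutative multiplicative Hom-algebra; the third,
    [malcev_exchange], is the linearized Malcev identity. The twists do not
    interfere: in every monomial, the exponent of [alpha] on a variable plus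
    the depth of that variable is the same number, the degree minus one, so
    the computation is the one for ordinary Malcev algebras.

    The remaining axioms are immediate from bilinearity, anticommutativity and
    multiplicativity. *)

(** * Linear relations in abelian groups *)

Lemma addr_eq0_cancel (V : zmodType) (x s s' : V) :
  s = - x + s' -> s' = 0 -> x + s = 0.
Proof. by move=> -> ->; rewrite GRing.addr0 GRing.subrr. Qed.

Lemma oppr_eq0_cancel (V : zmodType) (x s s' : V) :
  s = x + s' -> s' = 0 -> - x + s = 0.
Proof. by move=> -> ->; rewrite GRing.addr0 GRing.addNr. Qed.

Lemma addr_pull (V : zmodType) (t x s s' : V) :
  s = t + s' -> x + s = t + (x + s').
Proof. by move=> ->; rewrite GRing.addrCA. Qed.

(** Adding the known relation [p = q] to a goal and then collecting terms
    proves that the goal is a consequence of it; iterating gives arbitrary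
    integer linear combinations of relations. *)
Lemma addr_relation (V : zmodType) (p q x y : V) :
  p = q -> x + p = y + q -> x = y.
Proof. by move=> -> /GRing.addIr. Qed.

(** In a goal [s = t + ?s'], with [s] a sum nested to the right, brings the
    summand [t] to the front and thereby determines [?s']. *)
Ltac pull_term := first [reflexivity | apply: addr_pull; pull_term].

Ltac cancel_terms :=
  first
  [ reflexivity
  | eapply oppr_eq0_cancel; [pull_term | cancel_terms]
  | eapply addr_eq0_cancel; [pull_term | cancel_terms] ].

(** * Anticommutative multiplicative Hom-algebras *)

Section HomMalcev.

Import GRing.Theory.

(** Decides equality of integer combinations of atoms in an abelian group:
    all terms go to one side, and each is cancelled against an opposite. *)
Ltac abelian :=
  apply/eqP; rewrite -subr_eq0; apply/eqP;
  rewrite ?(mulr2n, mulrS, mulr0n) ?(opprD, opprK, oppr0);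
  rewrite -[LHS]addr0 -?addrA ?(add0r, addr0);
  rewrite -[LHS]addr0 -?addrA; cancel_terms.

Variables (K : fieldType) (A : lmodType K).
Variables (mul : A -> A -> A) (alpha : A -> A).
Hypothesis homA : hom_algebra mul alpha.
Hypothesis antiA : anticommutative mul.
Hypothesis multA : Defs.multiplicative mul alpha.

Local Infix "**" := mul (at level 40, left associativity).
Local Notation J := (hom_jacobian mul alpha).
Local Notation tri := (hom_triple mul alpha).

Lemma mulC x y : x ** y = - (y ** x).
Proof. exact: antiA. Qed.

Lemma mul_linearl k x x' y : (k *: x + x') ** y = k *: (x ** y) + x' ** y.
Proof. by case: homA => -[H _] _; apply: H. Qed.

Lemma mul_linearr k x y y' : x ** (k *: y + y') = k *: (x ** y) + x ** y'.
Proof. by case: homA => -[_ H] _; apply: H. Qed.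

Lemma alpha_linear k x y : alpha (k *: x + y) = k *: alpha x + alpha y.
Proof. by case: homA => _ H; apply: H. Qed.

Lemma mulDl x x' y : (x + x') ** y = x ** y + x' ** y.
Proof. by have := mul_linearl 1 x x' y; rewrite !scale1r. Qed.

Lemma mulDr x y y' : x ** (y + y') = x ** y + x ** y'.
Proof. by have := mul_linearr 1 x y y'; rewrite !scale1r. Qed.

Lemma alphaD x y : alpha (x + y) = alpha x + alpha y.
Proof. by have := alpha_linear 1 x y; rewrite !scale1r. Qed.

Lemma mul0l y : 0 ** y = 0.
Proof. by apply: (@addrI _ (0 ** y)); rewrite -mulDl !addr0. Qed.

Lemma mulNl x y : (- x) ** y = - (x ** y).
Proof. by apply: (@addrI _ (x ** y)); rewrite -mulDl !subrr mul0l. Qed.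

Lemma mulNr x y : x ** (- y) = - (x ** y).
Proof. by rewrite mulC mulNl -mulC. Qed.

Lemma alphaN x : alpha (- x) = - alpha x.
Proof.
apply: (@addrI _ (alpha x)); rewrite -alphaD !subrr.
by apply: (@addrI _ (alpha 0)); rewrite -alphaD !addr0.
Qed.

Definition expandE := (mulDl, mulDr, alphaD, mulNl, mulNr, alphaN, multA).

Lemma jacobian_cycle x y z : J x y z = J y z x.
Proof. by rewrite /hom_jacobian; abelian. Qed.

Lemma jacobian_skew x y z : J y x z = - J x y z.
Proof.
rewrite /hom_jacobian (mulC y x) (mulC x z) (mulC z y) !mulNl.
by abelian.
Qed.

Lemma jacobian_skewr x y z : J x z y = - J x y z.
Proof. by rewrite -jacobian_cycle jacobian_skew jacobian_cycle. Qed.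

Lemma jacobianNl x y z : J (- x) y z = - J x y z.
Proof. by rewrite /hom_jacobian !expandE; abelian. Qed.

(** Each monomial [((p ** q) ** r) ** s] occurs once in a Jacobian on the left
    and once on the right. The monomials [(p ** q) ** (r ** s)] occur only on
    the left, twice with opposite signs, since complementary pairs of
    variables enter in both orders. *)
Lemma jacobian_teichmuller a u v w :
  J (u ** v) (alpha a) (alpha w) + J (v ** w) (alpha a) (alpha u)
  + J (w ** u) (alpha a) (alpha v) + J (a ** u) (alpha v) (alpha w)
  + J (a ** v) (alpha w) (alpha u) + J (a ** w) (alpha u) (alpha v)
  = J a u v ** alpha (alpha w) + J a w u ** alpha (alpha v)
    + J a v w ** alpha (alpha u) - J u v w ** alpha (alpha a).
Proof.
rewrite /hom_jacobian !expandE.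
rewrite (mulC w a) (mulC v a) (mulC u a).
rewrite (mulC (alpha w) (u ** v)) (mulC (alpha u) (v ** w)).
rewrite (mulC (alpha v) (w ** u)) (mulC (alpha w) (a ** u)).
rewrite (mulC (alpha u) (a ** v)) (mulC (alpha v) (a ** w)).
rewrite (mulC (alpha a ** alpha w)) (mulC (alpha a ** alpha u)).
rewrite (mulC (alpha a ** alpha v)) !expandE.
by abelian.
Qed.

(** As an operator in the last variable, and up to twisting by [alpha], the
    triple product is [2 L_(x ** y) + [L_x, L_y]], where [L] denotes left
    multiplication. This is why derivations by left multiplications suffice
    for [triple_nambu]. *)
Lemma tripleE x y z :
  tri x y z = (x ** y) ** alpha z *+ 2 + alpha x ** (y ** z)
              - alpha y ** (x ** z).
Proof.
rewrite /hom_triple scaler_nat (mulC (y ** z)) (mulC z) mulNl.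
by rewrite (mulC (x ** z)) !opprK.
Qed.

(** This form separates the part of the triple product that a Lie algebra
    already has from the Jacobian, to which the Malcev identity applies. *)
Lemma triple_jacobian x y z :
  tri x y z = (x ** y) ** alpha z *+ 3 - J x y z.
Proof. by rewrite /hom_triple /hom_jacobian scaler_nat; abelian. Qed.

(** Twists omitted, [(a ** u) ** v + u ** (a ** v)] is [J a u v] minus
    [(u ** v) ** a]; multiplied by [w], that last term completes the other two
    to [J (u ** v) a w]. Thus Jacobians alone measure how far left
    multiplication by [a] is from being a derivation of [(u ** v) ** w]. *)
Lemma mul_derivation_defect a u v w :
  alpha (alpha a) ** ((u ** v) ** alpha w)
  - ((a ** u) ** alpha v) ** alpha (alpha w)
  - (alpha u ** (a ** v)) ** alpha (alpha w)
  - alpha (u ** v) ** alpha (a ** w)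
  = J (u ** v) (alpha a) (alpha w) - J a u v ** alpha (alpha w).
Proof.
rewrite /hom_jacobian !expandE.
rewrite (mulC (alpha (alpha a))) (mulC (alpha u) (a ** v)) (mulC v a).
rewrite (mulC (alpha w)) (mulC (alpha a ** alpha w)) !expandE.
by abelian.
Qed.

Lemma triple_skew x y z : tri x y z = - tri y x z.
Proof. by rewrite !tripleE (mulC y x) mulNl; abelian. Qed.

Lemma triple_cyclic x y z : tri x y z + tri y z x + tri z x y = 0.
Proof. by rewrite /hom_triple !scaler_nat; abelian. Qed.

Lemma triple_linear3 x y : linear (tri x y).
Proof.
move=> k z z'; rewrite !tripleE !(alpha_linear, mul_linearr).
by rewrite !(mulr2n, scalerDr, scalerN); abelian.
Qed.

Lemma triple_linear1 y z : linear (fun x => tri x y z).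
Proof.
move=> k x x' /=; rewrite !tripleE.
rewrite !(alpha_linear, mul_linearl, mul_linearr).
by rewrite !(mulr2n, scalerDr, scalerN); abelian.
Qed.

Lemma triple_linear2 x z : linear (fun y => tri x y z).
Proof.
move=> k y y' /=; rewrite !(triple_skew x) triple_linear1.
by rewrite opprD scalerN.
Qed.

Lemma triple_multiplicative x y z :
  alpha (tri x y z) = tri (alpha x) (alpha y) (alpha z).
Proof. by rewrite !tripleE !mulr2n !expandE. Qed.

Lemma tripleDl x x' y z : tri (x + x') y z = tri x y z + tri x' y z.
Proof. by have := triple_linear1 y z 1 x x'; rewrite !scale1r. Qed.

Lemma tripleNl x y z : tri (- x) y z = - tri x y z.
Proof.
apply/eqP; rewrite -addr_eq0 -tripleDl addNr; apply/eqP.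
by apply: (@addrI _ (tri 0 y z)); rewrite -tripleDl !addr0.
Qed.

Lemma tripleDm x y y' z : tri x (y + y') z = tri x y z + tri x y' z.
Proof. by rewrite !(triple_skew x) tripleDl opprD. Qed.

Lemma tripleNm x y z : tri x (- y) z = - tri x y z.
Proof. by rewrite !(triple_skew x) tripleNl. Qed.

Lemma tripleDr x y z z' : tri x y (z + z') = tri x y z + tri x y z'.
Proof. by have := triple_linear3 x y 1 z z'; rewrite !scale1r. Qed.

Lemma tripleNr x y z : tri x y (- z) = - tri x y z.
Proof.
apply/eqP; rewrite -addr_eq0 -tripleDr addNr; apply/eqP.
by apply: (@addrI _ (tri x y 0)); rewrite -tripleDr !addr0.
Qed.

(** * Consequences of the Malcev identity *)

Hypothesis malcev_id : forall x y z,
  J (alpha x) (alpha y) (x ** z) = J x y z ** iter 2 alpha x.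

(** Polarization of the Malcev identity in the variable that occurs twice:
    its value at [x + w] minus those at [x] and at [w]. *)
Lemma malcev_linearized x w y z :
  J (alpha x) (alpha y) (w ** z) + J (alpha w) (alpha y) (x ** z)
  = J x y z ** alpha (alpha w) + J w y z ** alpha (alpha x).
Proof.
have := malcev_id (x + w) y z; have := malcev_id x y z.
have := malcev_id w y z.
rewrite /= /hom_jacobian !expandE => Mw Mx Mxw.
apply: (addr_relation (esym Mxw)); apply: (addr_relation Mx).
apply: (addr_relation Mw).
by abelian.
Qed.

(** The linearized identity with the products moved to the first argument.
    In this form it says that, twists omitted, [J (z ** x) y w] and
    [J (w ** z) y x] agree up to terms [J _ _ _ ** _], so that all six
    Jacobians of a product of two of the four variables agree, up to sign,
    modulo such terms. *)
Lemma malcev_exchange x w y z :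
  J (z ** x) (alpha y) (alpha w) - J (w ** z) (alpha y) (alpha x)
  = J x y z ** alpha (alpha w) + J w y z ** alpha (alpha x).
Proof.
rewrite -malcev_linearized addrC !(jacobian_cycle (alpha _)).
rewrite (mulC z x) jacobianNl (jacobian_skewr _ (alpha w)).
by rewrite (jacobian_skewr _ (alpha x)) !opprK.
Qed.

(** By [triple_jacobian], the defect of this equality is three times that of
    [mul_derivation_defect] minus the defect of [a] acting on [J u v w]. The
    latter contains three of the six Jacobians of [jacobian_teichmuller]; two
    uses of [malcev_exchange] turn the other three into copies of
    [J (u ** v) (alpha a) (alpha w)], which then cancel against the factor
    three. *)
Lemma left_mul_triple_derivation a u v w :
  alpha (alpha a) ** tri u v w
  = tri (a ** u) (alpha v) (alpha w) + tri (alpha u) (a ** v) (alpha w)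
    + tri (alpha u) (alpha v) (a ** w).
Proof.
have D := mul_derivation_defect a u v w.
have T := jacobian_teichmuller a u v w.
have := malcev_exchange v w a u; have := malcev_exchange w u a v.
rewrite (jacobian_cycle w a v) (jacobian_cycle v a u).
rewrite (jacobian_skew a u v) (jacobian_skew a w u) !mulNl => L1 L2.
rewrite (mulC (J u v w)) opprK in T.
rewrite !triple_jacobian -multA !(mulrS, mulr0n, addr0).
rewrite (jacobian_cycle (alpha u) (a ** v)) -(jacobian_cycle (a ** w)).
(* [mulDr] also distributes over the unfolded Jacobian; it is folded back. *)
rewrite mulDr mulNr !(mulDr _ (_ ** _)) -/(J u v w).
do 3 apply: (addr_relation (esym D)).
apply: (addr_relation (esym T)); apply: (addr_relation L1).
apply: (addr_relation (esym L2)).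
by abelian.
Qed.

(** By [tripleE], acting with [x] and [y] is [2 L_(x ** y) + [L_x, L_y]], and
    sums and commutators of derivations are derivations: the terms in which
    [x] and [y] hit different arguments are symmetric in [x] and [y], and
    disappear in the commutator. *)
Lemma triple_nambu x y u v w :
  tri (iter 2 alpha x) (iter 2 alpha y) (tri u v w)
  = tri (tri x y u) (iter 2 alpha v) (iter 2 alpha w)
    + tri (iter 2 alpha u) (tri x y v) (iter 2 alpha w)
    + tri (iter 2 alpha u) (iter 2 alpha v) (tri x y w).
Proof.
rewrite /= (tripleE (alpha (alpha x))) triple_multiplicative.
(* Exhibit the first left factor as [alpha (alpha (x ** y))]. *)
rewrite -(multA (alpha x)) -(multA x).
rewrite !left_mul_triple_derivation !(mulDr _ _ (tri _ _ _)).
rewrite !left_mul_triple_derivation.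
rewrite (tripleE x y u) (tripleE x y v) (tripleE x y w) !mulr2n.
rewrite !(tripleDl, tripleDm, tripleDr) !(tripleNl, tripleNm, tripleNr).
by rewrite !multA; abelian.
Qed.

End HomMalcev.

Theorem theorem3p2 (K : closedFieldType) (charK0 : [pchar K] =i pred0)
  (A : lmodType K) (mul : A -> A -> A) (alpha : A -> A)
  (malcevA : hom_malcev_algebra mul alpha)
  (multA : multiplicative mul alpha) :
  multiplicative_hom_lie_triple_system (hom_triple mul alpha) (iter 2 alpha).
Proof.
case: malcevA => homA antiA malcev_id; split.
- split=> [y z | x z | x y]; first exact: triple_linear1.
    exact: triple_linear2.
  exact: triple_linear3.
- by move=> k x y; rewrite /= !(alpha_linear homA).
- by move=> x y z; rewrite /= !triple_multiplicative.
- exact: triple_skew.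
- exact: triple_cyclic.
- exact: triple_nambu.
Qed.
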